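(* Let $(X,d)$ be a pointed metric space and let $((x_i,y_i))_{i\in I}$ be a Lipschitz interpolating family in $\widetilde X$ for $\mathrm{Lip}_0(X)$ whose Lipschitz interpolation constant is $1$. Then there exists a Beurling set of functions in $\mathrm{Lip}_0(X)$ for $((x_i,y_i))_{i\in I}$, i.e. a family $(f_i)_{i\in I}$ of functions $X\to\mathbb R$ with $f_i(0)=0$, $(f_i(x_j)-f_i(y_j))/d(x_j,y_j)=\delta_{ij}$ for all $i,j\in I$, and $\sup_{(x,y)\in\widetilde X}\sum_{i\in I}|f_i(x)-f_i(y)|/d(x,y)\leq 1$.
   Context: All spaces are real. $(X,d)$ is a metric space with base point $0$, $\widetilde{X}=\{(x,y)\in X\times X: x\neq y\}$. $\mathrm{Lip}_0(X)$ is the Banach space of Lipschitz $f:X\to\mathbb{R}$ with $f(0)=0$, normed by $\|f\|=\sup_{(x,y)\in\widetilde X}|f(x)-f(y)|/d(x,y)$. For a family $((x_i,y_i))_{i\in I}$ in $\widetilde X$, $T:\mathrm{Lip}_0(X)\to\ell_\infty(I)$, $T(f)=\big((f(x_i)-f(y_i))/d(x_i,y_i)\big)_{i\in I}$; the family is Lipschitz interpolating for $\mathrm{Lip}_0(X)$ if $T$ is surjective, and then its Lipschitz interpolation constant is $\inf\{K\geq 1: \forall \alpha\in\ell_\infty(I), \|\alpha\|_\infty\le1,\ \exists f\in\mathrm{Lip}_0(X),\ \|f\|\le K,\ T(f)=\alpha\}$. *)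

(* Defs.v *)
From Stdlib Require Import Reals Lra List.
Open Scope R_scope.

Definition is_metric (X : Type) (d : X -> X -> R) : Prop :=
  (forall x y, 0 <= d x y) /\
  (forall x y, d x y = 0 <-> x = y) /\
  (forall x y, d x y = d y x) /\
  (forall x y z, d x z <= d x y + d y z).

Definition is_Lip0 {X : Type} (d : X -> X -> R) (x0 : X) (f : X -> R) : Prop :=
  f x0 = 0 /\ exists L, forall x y, x <> y -> Rabs (f x - f y) / d x y <= L.

Definition lip_norm_le {X : Type} (d : X -> X -> R) (f : X -> R) (K : R) : Prop :=
  forall x y, x <> y -> Rabs (f x - f y) / d x y <= K.

Definition bounded {I : Type} (a : I -> R) : Prop :=
  exists M, forall i, Rabs (a i) <= M.

Definition sup_norm_le {I : Type} (a : I -> R) (M : R) : Prop :=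
  forall i, Rabs (a i) <= M.

Definition Tmap {X I : Type} (d : X -> X -> R) (x y : I -> X) (f : X -> R) : I -> R :=
  fun i => (f (x i) - f (y i)) / d (x i) (y i).

Definition lip_interpolating {X I : Type} (d : X -> X -> R) (x0 : X)
  (x y : I -> X) : Prop :=
  forall a : I -> R, bounded a ->
    exists f, is_Lip0 d x0 f /\ Tmap d x y f = a.

Definition interp_const_set {X I : Type} (d : X -> X -> R) (x0 : X)
  (x y : I -> X) (K : R) : Prop :=
  1 <= K /\
  forall a : I -> R, sup_norm_le a 1 ->
    exists f, is_Lip0 d x0 f /\ lip_norm_le d f K /\ Tmap d x y f = a.

Definition is_inf (S : R -> Prop) (m : R) : Prop :=
  (forall K, S K -> m <= K) /\
  (forall m', (forall K, S K -> m' <= K) -> m' <= m).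

Definition lip_interp_constant {X I : Type} (d : X -> X -> R) (x0 : X)
  (x y : I -> X) (c : R) : Prop :=
  is_inf (interp_const_set d x0 x y) c.

Definition lsum {I : Type} (g : I -> R) (l : list I) : R :=
  fold_right (fun i acc => g i + acc) 0 l.

(* sup_{(x,y) in X~} sum_{i in I} |f_i x - f_i y| / d(x,y) <= 1; the sum of
   nonnegative terms over an arbitrary index set is the supremum of its finite
   partial sums (finite sets of indices given as duplicate-free lists). *)
Definition beurling_sum_le {X I : Type} (d : X -> X -> R) (f : I -> X -> R)
  (M : R) : Prop :=
  forall u v, u <> v -> forall l : list I, NoDup l ->
    lsum (fun i => Rabs (f i u - f i v) / d u v) l <= M.

(* Main.v *)
Require Import Defs.
From Stdlib Require Import Reals Lra Lia Arith List Permutation Classical ClassicalEpsilon.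
From mathcomp Require filter.
Import ListNotations.
Open Scope R_scope.

(** Interpolation of all signs with constants tending to 1 forces, for every finite set of
    indices, the pairs [(x_i, y_i)] to be a perfect matching of minimal cost of their endpoints:
    for any other matching, orient the pairs along the cycles formed by the two matchings and
    test against the corresponding interpolating function.

    Conversely, let [M] be a minimal matching of a finite multiset [T] in a pseudometric space.
    Following Sebő's proof of Seymour's theorem on packing [T]-cuts, choose a geodesic from [u]
    to [t] lying in some minimal [T]-join and of maximal length. By maximality [t] is a leaf of
    every minimal [T]-join, so collapsing a small ball of radius [e] around [t] keeps [M] minimal
    and shortens exactly one pair [(x_i, y_i)], by [e]; the loss of distance dominates the
    increments of [min (d(., t), e)], which is added to [f_i] up to sign. A reduction with the
    least remaining cost of [M], which exists by compactness, must have remaining cost 0. This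
    gives the functions for finitely many indices, and a limit along an ultrafilter gives them
    for all indices. *)

(** * Finite sums over lists *)

#[local] Arguments lsum : simpl never.

Lemma lsum_nil {A : Type} (g : A -> R) : lsum g [] = 0.
Proof. reflexivity. Qed.

Lemma lsum_cons {A : Type} (g : A -> R) (a : A) (l : list A) :
  lsum g (a :: l) = g a + lsum g l.
Proof. reflexivity. Qed.

Lemma lsum_perm {A : Type} (g : A -> R) (l l' : list A) :
  Permutation l l' -> lsum g l = lsum g l'.
Proof. induction 1; rewrite ?lsum_cons in *; lra. Qed.

Lemma lsum_le {A : Type} (g h : A -> R) (l : list A) :
  (forall a, In a l -> g a <= h a) -> lsum g l <= lsum h l.
Proof.
  induction l as [|a l IH]; intros H; rewrite ?lsum_cons; [apply Rle_refl|].
  apply Rplus_le_compat; simpl in H; auto.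
Qed.

Lemma lsum_ext {A : Type} (g h : A -> R) (l : list A) :
  (forall a, In a l -> g a = h a) -> lsum g l = lsum h l.
Proof.
  intros H; apply Rle_antisym; apply lsum_le; intros a Ha; rewrite (H a Ha); lra.
Qed.

Lemma lsum_scal {A : Type} (k : R) (g : A -> R) (l : list A) :
  lsum (fun a => k * g a) l = k * lsum g l.
Proof. induction l as [|a l IH]; rewrite ?lsum_nil, ?lsum_cons; lra. Qed.

Lemma lsum_nonneg {A : Type} (g : A -> R) (l : list A) :
  (forall a, In a l -> 0 <= g a) -> 0 <= lsum g l.
Proof.
  intros H; replace 0 with (lsum (fun a => 0 * g a) l) by (rewrite lsum_scal; lra).
  apply lsum_le; intros a Ha; specialize (H a Ha); lra.
Qed.

(** * Multisets as lists up to permutation *)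

Lemma in_perm_cons {A : Type} (a : A) (l : list A) :
  In a l -> exists l', Permutation l (a :: l').
Proof.
  intros H; destruct (in_split _ _ H) as (l1 & l2 & ->).
  exists (l1 ++ l2); symmetry; apply Permutation_middle.
Qed.

Definition eq_dec_classic {A : Type} (a b : A) : {a = b} + {a <> b} :=
  excluded_middle_informative (a = b).

(** Kept apart from [mult] so that [perm] leaves [hits z a] as an atom for linear arithmetic. *)
Definition hits {A : Type} (z a : A) : nat := if eq_dec_classic a z then 1 else 0.

Fixpoint mult {A : Type} (z : A) (l : list A) : nat :=
  match l with [] => 0 | a :: l' => hits z a + mult z l' end.

Lemma mult_app {A : Type} (z : A) (l l' : list A) :
  mult z (l ++ l') = (mult z l + mult z l')%nat.
Proof. induction l as [|a l IH]; simpl; lia. Qed.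

Lemma perm_mult {A : Type} (l l' : list A) :
  Permutation l l' <-> forall z, mult z l = mult z l'.
Proof.
  assert (E : forall z k, mult z k = count_occ (@eq_dec_classic A) k z).
  { intros z; induction k as [|a k IH]; simpl; auto.
    unfold hits; destruct (eq_dec_classic a z); lia. }
  rewrite (Permutation_count_occ (@eq_dec_classic A)).
  split; intros H z; specialize (H z); rewrite ?E in *; auto.
Qed.

(* Decides multiset equations that follow linearly from the permutations in the context. *)
Ltac perm :=
  apply perm_mult; let z := fresh "z" in intros z;
  repeat match goal with
  | H : Permutation _ _ |- _ => apply perm_mult with (z := z) in H
  end;
  repeat progress (rewrite ?mult_app in *; cbn [mult app] in *); lia.

(** * Matchings of finite multisets in a pseudometric space *)

Definition is_pseudometric {X : Type} (d : X -> X -> R) : Prop :=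
  (forall a, d a a = 0) /\ (forall a b, d a b = d b a) /\
  (forall a b c, d a c <= d a b + d b c).

Lemma pseudometric_nonneg {X : Type} (d : X -> X -> R) :
  is_pseudometric d -> forall a b, 0 <= d a b.
Proof.
  intros (Hr & Hs & Ht) a b. generalize (Ht a b a); rewrite (Hr a), (Hs b a); lra.
Qed.

Definition ends {X : Type} (L : list (X * X)) : list X :=
  flat_map (fun e => [fst e; snd e]) L.

Definition cost {X : Type} (d : X -> X -> R) (L : list (X * X)) : R :=
  lsum (fun e => d (fst e) (snd e)) L.

(* [T] stands for a multiset: its repeated entries are separate points to be matched. *)
Definition matched {X : Type} (d : X -> X -> R) (T : list X) (r : R) : Prop :=
  exists L, Permutation (ends L) T /\ cost d L = r.

Lemma ends_perm {X : Type} (L L' : list (X * X)) :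
  Permutation L L' -> Permutation (ends L) (ends L').
Proof. intros H; unfold ends; rewrite H; reflexivity. Qed.

Lemma matched_perm {X : Type} (d : X -> X -> R) (T T' : list X) (r : R) :
  Permutation T T' -> matched d T r -> matched d T' r.
Proof. intros H (L & HL & E); exists L; split; auto; perm. Qed.

Lemma matched_cons {X : Type} (d : X -> X -> R) (a b : X) (T : list X) (r : R) :
  matched d T r -> matched d (a :: b :: T) (d a b + r).
Proof.
  intros (L & HL & <-); exists ((a, b) :: L); split; [|reflexivity].
  simpl; perm.
Qed.

Lemma matched_inv {X : Type} (d : X -> X -> R) (t : X) (T : list X) (r : R) :
  (forall a b, d a b = d b a) -> matched d (t :: T) r ->
  exists p T0 r0, Permutation T (p :: T0) /\ matched d T0 r0 /\ r = d t p + r0.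
Proof.
  intros Hs (L & HL & <-).
  assert (Ht : In t (ends L)) by (rewrite HL; simpl; auto).
  apply in_flat_map in Ht; destruct Ht as ((a, b) & He & Hin).
  destruct (in_perm_cons _ _ He) as (L0 & HL0).
  assert (Hp := ends_perm _ _ HL0); simpl in Hp.
  unfold cost; rewrite (lsum_perm _ _ _ HL0), lsum_cons; simpl.
  simpl in Hin; destruct Hin as [<-|[<-|[]]].
  - exists b, (ends L0), (cost d L0); repeat split; [perm|exists L0; auto].
  - exists a, (ends L0), (cost d L0); repeat split; [perm|exists L0; auto|].
    rewrite (Hs b a); reflexivity.
Qed.

(** If [b] and [c] are partners, drop their pair; otherwise join their partners [p] and [q], using
    [d p q <= d p b + d b c + d c q]. *)
Lemma matched_splice {X : Type} (d : X -> X -> R) (b c : X) (T : list X) (r : R) :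
  is_pseudometric d -> matched d (b :: c :: T) r ->
  exists r', matched d T r' /\ r' <= r + d b c.
Proof.
  intros Hd Hm; assert (H0 := pseudometric_nonneg d Hd); destruct Hd as (Hr & Hs & Ht).
  destruct (matched_inv d _ _ _ Hs Hm) as (p & T0 & r0 & HT & Hm0 & ->).
  destruct (classic (p = c)) as [->|Hpc].
  - exists r0; split; [apply (matched_perm d T0); auto; perm|].
    generalize (H0 b c); lra.
  - assert (Hc : In c T0).
    { assert (In c (p :: T0)) as [|] by (rewrite <- HT; simpl; auto); congruence. }
    destruct (in_perm_cons _ _ Hc) as (T1 & HT1).
    assert (Hm1 := matched_perm d _ _ _ HT1 Hm0).
    destruct (matched_inv d _ _ _ Hs Hm1) as (q & T2 & r2 & HT2 & Hm2 & ->).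
    exists (d p q + r2); split.
    + apply (matched_perm d (p :: q :: T2)); [perm|]; apply matched_cons; auto.
    + generalize (Ht p b q) (Ht b c q) (Hs p b); lra.
Qed.

(* The walk from [t] that alternates between the two matchings continues at every point of [T],
   so it ends in [A] or [B]; exchanging the matchings along it preserves the total cost. *)
Lemma matched_exchange {X : Type} (d : X -> X -> R) (Hs : forall a b, d a b = d b a) :
  forall (n : nat) (t : X) (T A B : list X) (r s : R), length T = n ->
  matched d (t :: T ++ A) r -> matched d (T ++ B) s ->
  (exists a A' r' s', Permutation A (a :: A') /\ matched d (T ++ A') r' /\
     matched d (t :: a :: T ++ B) s' /\ r' + s' = r + s) \/
  (exists b B' r' s', Permutation B (b :: B') /\ matched d (b :: T ++ A) r' /\
     matched d (t :: T ++ B') s' /\ r' + s' = r + s).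
Proof.
  induction n as [|n IH]; intros t T A B r s Hn HM HN;
  destruct (matched_inv d _ _ _ Hs HM) as (p & T0 & r0 & HT & Hm0 & ->);
  (destruct (classic (In p A)) as [HA|HA];
   [left; destruct (in_perm_cons _ _ HA) as (A' & HA');
    exists p, A', r0, (d t p + s); repeat split;
      [auto|apply (matched_perm d T0); auto; perm|apply matched_cons; auto|lra]|]);
  (assert (Hp : In p T);
   [assert (Hp : In p (T ++ A)) by (rewrite HT; simpl; auto);
    apply in_app_or in Hp; tauto|]).
  - destruct T; [destruct Hp|discriminate].
  - destruct (in_perm_cons _ _ Hp) as (T1 & HT1).
    assert (Hn1 : length T1 = n).
    { apply Permutation_length in HT1; simpl in HT1; lia. }
    assert (HN1 : matched d (p :: T1 ++ B) s) by (apply (matched_perm d (T ++ B)); auto; perm).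
    assert (HM1 : matched d (T1 ++ A) r0) by (apply (matched_perm d T0); auto; perm).
    destruct (IH p T1 B A s r0 Hn1 HN1 HM1)
      as [(b & B' & s' & r' & HB & H1 & H2 & E)|(a & A' & s' & r' & HA' & H1 & H2 & E)].
    + right; exists b, B', r', (d t p + s'); repeat split; auto; [| |lra].
      * apply (matched_perm d (p :: b :: T1 ++ A)); auto; perm.
      * apply (matched_perm d (t :: p :: T1 ++ B')); [perm|apply matched_cons; auto].
    + left; exists a, A', r', (d t p + s'); repeat split; auto; [| |lra].
      * apply (matched_perm d (p :: T1 ++ A')); auto; perm.
      * apply (matched_perm d (t :: p :: a :: T1 ++ B)); [perm|apply matched_cons; auto].
Qed.

(** * Positive gaps between the costs of matchings *)

Lemma uniform_positive {A : Type} (Q : A -> R -> Prop) (l : list A) :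
  (forall a e e', Q a e -> e' <= e -> Q a e') ->
  (forall a, In a l -> exists e, 0 < e /\ Q a e) ->
  exists e, 0 < e /\ forall a, In a l -> Q a e.
Proof.
  intros Hm; induction l as [|a l IH]; intros H.
  - exists 1; split; [lra|intros a []].
  - destruct (H a (or_introl eq_refl)) as (e1 & He1 & Hq1).
    destruct IH as (e2 & He2 & Hq2); [intros; apply H; simpl; auto|].
    exists (Rmin e1 e2); split; [apply Rmin_glb_lt; auto|].
    intros b [<-|Hb]; [apply (Hm _ e1)|apply (Hm _ e2)]; auto using Rmin_l, Rmin_r.
Qed.

(** A finite multiset has finitely many matchings, so no cost lies just above [k]; the induction
    splits on the partner of the first point. The gap turns strict inequalities into uniform
    margins. *)
Lemma matched_gap {X : Type} (d : X -> X -> R) (Hs : forall a b, d a b = d b a) :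
  forall (n : nat) (T : list X) (k : R), length T = n ->
  exists e, 0 < e /\ forall r, matched d T r -> r <= k \/ k + e <= r.
Proof.
  induction n as [n IH] using lt_wf_ind; intros T k Hn.
  destruct T as [|t T].
  (* The empty multiset has only the cost 0: for [k < 0] the gap reaches exactly up to 0, otherwise
     any positive gap serves. *)
  - exists (if Rlt_dec k 0 then - k else 1); destruct (Rlt_dec k 0) as [Hk|Hk]; (split; [lra|]);
    intros r (L & HL & <-); symmetry in HL; apply Permutation_nil in HL;
    (destruct L; [|discriminate]); unfold cost; rewrite lsum_nil; lra.
  - destruct (uniform_positive (fun p e => forall T0 r0, Permutation T (p :: T0) ->
      matched d T0 r0 -> d t p + r0 <= k \/ k + e <= d t p + r0) T) as (e & He & HQ).
    + intros p e e' H Hle T0 r0 H1 H2; destruct (H T0 r0 H1 H2); [left|right]; lra.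
    + intros p Hp; destruct (in_perm_cons _ _ Hp) as (T1 & HT1).
      destruct (IH (length T1)) with (T := T1) (k := k - d t p) as (e & He & H); auto.
      { apply Permutation_length in HT1; simpl in *; lia. }
      exists e; split; auto; intros T0 r0 HT0 Hm.
      destruct (H r0); [apply (matched_perm d T0); auto; perm|left|right]; lra.
    + exists e; split; auto; intros r Hr.
      destruct (matched_inv d _ _ _ Hs Hr) as (p & T0 & r0 & HT & Hm & ->).
      apply (HQ p) with (T0 := T0); auto. rewrite HT; simpl; auto.
Qed.

(** * Geodesics of maximal length in minimal joins *)

Lemma exists_argmax {A : Type} (P : A -> Prop) (g : A -> R) (l : list A) :
  (exists a, In a l /\ P a) ->
  exists a, In a l /\ P a /\ forall b, In b l -> P b -> g b <= g a.
Proof.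
  induction l as [|c l IH]; [intros (a & [] & _)|intros (a & Ha & Pa)].
  destruct (classic (exists a, In a l /\ P a)) as [H|H].
  - destruct (IH H) as (m & Hm & Pm & Hmax).
    destruct (classic (P c /\ g m < g c)) as [[Pc Hc]|Hc].
    + exists c; simpl; repeat split; auto; intros b [<-|Hb] Pb; [lra|].
      specialize (Hmax b Hb Pb); lra.
    + exists m; simpl; repeat split; auto; intros b [<-|Hb] Pb; [|auto].
      apply Rnot_lt_le; tauto.
  - assert (Pc : P c) by (destruct Ha as [->|Ha]; [auto|exfalso; eauto]).
    exists c; simpl; repeat split; auto; intros b [<-|Hb] Pb; [lra|exfalso; eauto].
Qed.

(* When [c] is the minimal cost of matching [T], this says that [u] and [t] are joined by a
   geodesic inside some minimal [T]-join. *)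
Definition geodesic {X : Type} (d : X -> X -> R) (T : list X) (c : R) (u t : X) : Prop :=
  exists r, matched d (u :: t :: T) r /\ r <= c - d u t.

Definition longest_geodesic {X : Type} (d : X -> X -> R) (T : list X) (c : R) (u t : X) : Prop :=
  In u T /\ In t T /\ geodesic d T c u t /\ 0 < d u t /\
  forall u' t', In u' T -> In t' T -> geodesic d T c u' t' -> d u' t' <= d u t.

Lemma matched_double {X : Type} (d : X -> X -> R) (T T' : list X) (a b : X) (r : R) :
  is_pseudometric d -> Permutation T (a :: b :: T') -> matched d T' r ->
  matched d (a :: b :: T) r.
Proof.
  intros (Hr & _) HT H; replace r with (d a a + (d b b + r)) by (rewrite !Hr; lra).
  apply (matched_perm d (a :: a :: b :: b :: T')); [perm|]; apply matched_cons, matched_cons; auto.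
Qed.

Lemma cost_perm_cons {X : Type} (d : X -> X -> R) (a b : X) (L L' : list (X * X)) :
  Permutation L ((a, b) :: L') -> cost d L = d a b + cost d L'.
Proof. intros H; unfold cost; rewrite (lsum_perm _ _ _ H), lsum_cons; reflexivity. Qed.

(** Once the endpoints of a pair of [M] are doubled, each can be matched to its own copy at cost 0,
    which saves exactly [d a b]. *)
Lemma edge_geodesic {X : Type} (d : X -> X -> R) (M : list (X * X)) (a b : X) :
  is_pseudometric d -> In (a, b) M -> geodesic d (ends M) (cost d M) a b.
Proof.
  intros Hd He; destruct (in_perm_cons _ _ He) as (M1 & HM1).
  exists (cost d M1); split.
  - apply (matched_double d _ (ends M1)); [auto|apply (ends_perm _ _ HM1)|exists M1; auto].
  - rewrite (cost_perm_cons d _ _ _ _ HM1); lra.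
Qed.

Lemma longest_geodesic_exists {X : Type} (d : X -> X -> R) (M : list (X * X)) :
  is_pseudometric d -> 0 < cost d M ->
  exists u t, longest_geodesic d (ends M) (cost d M) u t.
Proof.
  intros Hd Hpos.
  assert (Hex : exists e, In e M /\ 0 < d (fst e) (snd e)).
  { apply NNPP; intros H; apply (Rlt_irrefl 0); apply (Rlt_le_trans _ _ _ Hpos).
    replace 0 with (lsum (fun e : X * X => 0 * 1) M) by (rewrite lsum_scal; lra).
    apply lsum_le; intros e He; rewrite Rmult_0_l; apply Rnot_lt_le; intros Hl; apply H; eauto. }
  destruct Hex as ((a, b) & He & Hab); simpl in Hab.
  assert (Hg0 := edge_geodesic d M a b Hd He).
  set (T := ends M) in *.
  assert (Hin0 : In (a, b) (list_prod T T)).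
  { apply in_prod; apply in_flat_map; exists (a, b); simpl; auto. }
  destruct (exists_argmax (fun e => geodesic d T (cost d M) (fst e) (snd e))
     (fun e => d (fst e) (snd e)) (list_prod T T)) as ((u, t) & Hin & Hg & Hmax).
  - exists (a, b); auto.
  - exists u, t; apply in_prod_iff in Hin; destruct Hin; simpl in *.
    repeat split; auto.
    + apply (Rlt_le_trans _ _ _ Hab), (Hmax (a, b)); auto.
    + intros u' t' Hu Ht Hg'; apply (Hmax (u', t')); auto; apply in_prod; auto.
Qed.

(** Otherwise [u] and [b] would be joined by a geodesic, so [d u b <= d u t] by maximality; but
    splicing out [u] and [b] and minimality of [c] give [d u b >= d u t + d b t]. *)
Lemma longest_geodesic_extension {X : Type} (d : X -> X -> R) (T : list X) (c : R) (u t b : X)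
  (r : R) :
  is_pseudometric d -> (forall r, matched d T r -> c <= r) -> longest_geodesic d T c u t ->
  In b T -> 0 < d b t -> matched d (u :: b :: T) r -> c - d u t - d b t < r.
Proof.
  intros Hd Hc (Hu & Ht & _ & _ & Hmax) Hb Hbt Hm.
  apply Rnot_le_lt; intros Hle.
  destruct (matched_splice d _ _ _ _ Hd Hm) as (r' & Hr' & Hle').
  apply Hc in Hr'; destruct Hd as (_ & Hs & Htri).
  assert (d u b <= d u t).
  { apply Hmax; auto; exists r; split; auto. generalize (Htri u t b) (Hs t b); lra. }
  lra.
Qed.

(* Exchanging a matching of [u, t, T] with one of [b, c, T] from [t] would extend the geodesic
   from [u] to [t] up to [b] or [c]. *)
Lemma longest_geodesic_end {X : Type} (d : X -> X -> R) (T : list X) (k : R) (u t b c : X)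
  (r : R) :
  is_pseudometric d -> (forall r, matched d T r -> k <= r) -> longest_geodesic d T k u t ->
  In b T -> In c T -> 0 < d b t -> 0 < d c t -> matched d (b :: c :: T) r ->
  k - d b t - d c t < r.
Proof.
  intros Hd Hk Hl Hb Hc Hbt Hct Hm.
  apply Rnot_le_lt; intros Hle.
  assert (Hfar := fun v r' => longest_geodesic_extension d T k u t v r' Hd Hk Hl).
  assert (Hs := proj1 (proj2 Hd)).
  assert (HLB : forall v r', matched d (t :: v :: T) r' -> k - d v t <= r').
  { intros v r' Hv; destruct (matched_splice d _ _ _ _ Hd Hv) as (r1 & H1 & H2).
    apply Hk in H1; rewrite (Hs v t); lra. }
  destruct Hl as (_ & _ & (r1 & Hr1 & Hle1) & _).
  destruct (matched_exchange d Hs (length T) t T [u] [b; c] r1 r eq_refl)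
    as [(a & A' & r' & s' & HA & H1 & H2 & E)|(a & B' & r' & s' & HB & H1 & H2 & E)].
  - apply (matched_perm d (u :: t :: T)); auto; perm.
  - apply (matched_perm d (b :: c :: T)); auto; perm.
  (* The walk ends in [u]: one new matching is of [T], hence costs at least [k], and splicing [t]
     and [c] out of the other leaves one of [u, b, T] that is too cheap for [Hfar]. *)
  - apply Permutation_length_1_inv in HA; injection HA as -> ->.
    apply (matched_perm d (T ++ []) T) in H1; [|perm]; apply Hk in H1.
    apply (matched_perm d _ (t :: c :: u :: b :: T)) in H2; [|perm].
    destruct (matched_splice d _ _ _ _ Hd H2) as (r2 & H3 & H4).
    apply Hfar in H3; auto. rewrite (Hs t c) in H4; lra.
  (* The walk ends in [b] or [c]: the bounds [Hfar] and [HLB] for the two new matchings add up to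
     more than [r1 + r]. *)
  - apply Permutation_length_2_inv in HB; destruct HB as [HB|HB]; injection HB as -> ->.
    + apply (matched_perm d _ (u :: b :: T)) in H1; [|perm]; apply Hfar in H1; auto.
      apply (matched_perm d _ (t :: c :: T)) in H2; [|perm]; apply HLB in H2; lra.
    + apply (matched_perm d _ (u :: c :: T)) in H1; [|perm]; apply Hfar in H1; auto.
      apply (matched_perm d _ (t :: b :: T)) in H2; [|perm]; apply HLB in H2; lra.
Qed.

(** * Pairs that leave the end of a longest geodesic *)

Definition crosses {X : Type} (d : X -> X -> R) (t : X) (e : X * X) : Prop :=
  (d (fst e) t = 0 /\ 0 < d (snd e) t) \/ (0 < d (fst e) t /\ d (snd e) t = 0).

(** The whole class of points at distance 0 from [t] matters, since a collapse identifies distinct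
    points. *)
Definition near {X : Type} (d : X -> X -> R) (t v : X) : bool :=
  if Req_dec_T (d v t) 0 then true else false.

(** A pair that does not cross has both endpoints in the class of [t] or none. *)
Lemma even_near_ends {X : Type} (d : X -> X -> R) (t : X) (L : list (X * X)) :
  is_pseudometric d -> (forall e, In e L -> ~ crosses d t e) ->
  Nat.Even (length (filter (near d t) (ends L))).
Proof.
  intros Hd; assert (H0 := pseudometric_nonneg d Hd).
  induction L as [|(a, b) L IH]; intros H; [exists 0%nat; reflexivity|].
  destruct IH as (m & Hm); [intros; apply H; simpl; auto|].
  assert (Hab := H (a, b) (or_introl eq_refl)); unfold crosses in Hab; simpl in Hab.
  generalize (H0 a t) (H0 b t); intros Ha Hb.
  change (ends ((a, b) :: L)) with (a :: b :: ends L); simpl.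
  unfold near at 1; destruct (Req_dec_T (d a t) 0);
  unfold near at 1; destruct (Req_dec_T (d b t) 0); simpl.
  - exists (S m); lia.
  - exfalso; apply Hab; left; lra.
  - exfalso; apply Hab; right; lra.
  - exists m; auto.
Qed.

Lemma filter_perm {A : Type} (f : A -> bool) (l l' : list A) :
  Permutation l l' -> Permutation (filter f l) (filter f l').
Proof.
  induction 1; simpl; auto.
  - destruct (f x); auto.
  - destruct (f x), (f y); auto; constructor.
  - etransitivity; eauto.
Qed.

Lemma crosses_oriented {X : Type} (d : X -> X -> R) (t a b : X) :
  is_pseudometric d -> crosses d t (a, b) ->
  exists s v, Permutation [a; b] [s; v] /\ d a b = d v t /\ d s t = 0 /\ 0 < d v t.
Proof.
  intros (_ & Hs & Ht) [(H1 & H2)|(H1 & H2)]; simpl in *;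
  [exists a, b|exists b, a]; repeat split; auto; try perm;
  generalize (Ht a t b) (Ht a b t) (Ht b a t) (Hs a b) (Hs t a) (Hs t b); lra.
Qed.

(* Otherwise the number of points of [T] at distance 0 from [t] would be even, so a matching of
   [u, t, T] would use an edge leaving that set, along which the geodesic could be extended. *)
Lemma longest_geodesic_crosses {X : Type} (d : X -> X -> R) (M : list (X * X)) (u t : X) :
  is_pseudometric d -> (forall r, matched d (ends M) r -> cost d M <= r) ->
  longest_geodesic d (ends M) (cost d M) u t -> exists e, In e M /\ crosses d t e.
Proof.
  intros Hd Hmin Hl; apply NNPP; intros Hno.
  assert (Hev : Nat.Even (length (filter (near d t) (ends M)))).
  { apply even_near_ends; auto; intros e He Hc; apply Hno; eauto. }
  assert (Hfar := fun v r' => longest_geodesic_extension d _ _ u t v r' Hd Hmin Hl).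
  destruct Hl as (Hu & Ht & (r & (L & HL & <-) & Hle) & Hut & _).
  assert (Hex : exists e, In e L /\ crosses d t e).
  { apply NNPP; intros Hno'.
    assert (Hev' : Nat.Even (length (filter (near d t) (ends L)))).
    { apply even_near_ends; auto; intros e He Hc; apply Hno'; eauto. }
    (* Of the two additional endpoints, [t] is near itself and [u] is not, so the parity changes. *)
    rewrite (Permutation_length (filter_perm (near d t) _ _ HL)) in Hev'; simpl in Hev'.
    unfold near at 1 in Hev'; destruct (Req_dec_T (d u t) 0); [lra|].
    unfold near at 1 in Hev'; destruct (Req_dec_T (d t t) 0) as [_|Hn];
      [|apply Hn, (proj1 Hd)].
    simpl in Hev'; destruct Hev as (m & Hm), Hev' as (m' & Hm'); lia. }
  destruct Hex as ((a, b) & He & Hc).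
  destruct (crosses_oriented d t a b Hd Hc) as (s & v & Hp & Hdab & Hst & Hvt).
  destruct (in_perm_cons _ _ He) as (L1 & HL1).
  assert (HL1' := ends_perm _ _ HL1); change (ends ((a, b) :: L1)) with (a :: b :: ends L1) in HL1'.
  assert (Hv : In v (ends M)).
  { assert (Hv : In v (u :: t :: ends M)).
    { rewrite <- HL, HL1'; assert (In v [a; b]) by (rewrite Hp; simpl; auto).
      simpl in *; tauto. }
    simpl in Hv; destruct Hv as [<-|[<-|Hv]]; auto. }
  rewrite (cost_perm_cons d _ _ _ _ HL1) in Hle.
  (* The pair of [s] and [v] is replaced by the pairs [(t, s)] and [(v, v)] of cost 0, which saves
     [d v t]; the two copies of [t] are then spliced out for free. *)
  assert (Hm1 : matched d (t :: t :: u :: v :: ends M) (cost d L1)).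
  { destruct Hd as (Hr & Hs & Htri).
    replace (cost d L1) with (d t s + (d v v + cost d L1)) by (rewrite Hr, Hs, Hst; lra).
    apply (matched_perm d (t :: s :: v :: v :: ends L1)); [perm|].
    apply matched_cons, matched_cons; exists L1; auto. }
  destruct (matched_splice d _ _ _ _ Hd Hm1) as (r' & Hr' & Hle').
  apply Hfar in Hr'; auto.
  rewrite (proj1 Hd) in Hle'; lra.
Qed.

(** * Collapsing a small ball *)

(* The distance after the ball of radius [e] around [t] has been collapsed to a point. *)
Definition collapse {X : Type} (d : X -> X -> R) (t : X) (e : R) (a b : X) : R :=
  Rmin (d a b) (Rmax 0 (d a t - e) + Rmax 0 (d b t - e)).

Lemma collapse_pseudometric {X : Type} (d : X -> X -> R) (t : X) (e : R) :
  is_pseudometric d -> is_pseudometric (collapse d t e).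
Proof.
  intros Hd; assert (H0 := pseudometric_nonneg d Hd); destruct Hd as (Hr & Hs & Ht).
  unfold collapse; repeat split.
  - intros a; rewrite Hr; unfold Rmin, Rmax; repeat destruct Rle_dec; lra.
  - intros a b; rewrite (Hs a b), Rplus_comm; reflexivity.
  - intros a b c; generalize (Ht a b c) (Ht a b t) (Ht c b t) (Hs b c) (H0 a b) (H0 b c).
    unfold Rmin, Rmax; repeat destruct Rle_dec; lra.
Qed.

(** If both points are at distance at least [e] from [t], the increment is 0. Otherwise increment
    and route through the ball add up to [Rabs (d a t - d b t)], which is at most [d a b]. *)
Lemma collapse_drop {X : Type} (d : X -> X -> R) (t : X) (e : R) (a b : X) :
  is_pseudometric d ->
  Rabs (Rmin (d a t) e - Rmin (d b t) e) <= d a b - collapse d t e a b.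
Proof.
  intros Hd; assert (H0 := pseudometric_nonneg d Hd a b); destruct Hd as (Hr & Hs & Ht).
  generalize (Ht a b t) (Ht b a t) (Hs a b).
  unfold collapse, Rmin, Rmax, Rabs; repeat destruct Rle_dec; destruct Rcase_abs; lra.
Qed.

Lemma collapse_le {X : Type} (d : X -> X -> R) (t : X) (e : R) (a b : X) :
  collapse d t e a b <= d a b.
Proof. apply Rmin_l. Qed.

Lemma collapse_cost_ge {X : Type} (d : X -> X -> R) (t : X) (e : R) (L : list (X * X)) :
  is_pseudometric d -> 0 <= e ->
  cost d L - 2 * e * INR (length L) <= cost (collapse d t e) L.
Proof.
  intros (Hr & Hs & Ht) He; induction L as [|(a, b) L IH].
  - unfold cost; rewrite !lsum_nil; simpl; lra.
  - unfold cost in *; rewrite !lsum_cons; cbn [length fst snd]; rewrite S_INR.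
    enough (d a b - 2 * e <= collapse d t e a b) by lra.
    generalize (Ht a t b) (Hs t b); unfold collapse, Rmin, Rmax; repeat destruct Rle_dec; lra.
Qed.

(** The strict bound of [longest_geodesic_end] holds with a common margin because only finitely many
    [b], [c] and costs occur. *)
Lemma longest_geodesic_gap {X : Type} (d : X -> X -> R) (T : list X) (k : R) (u t : X) :
  is_pseudometric d -> (forall r, matched d T r -> k <= r) -> longest_geodesic d T k u t ->
  exists e, 0 < e /\ forall b c r, In b T -> In c T -> 0 < d b t -> 0 < d c t ->
    matched d (b :: c :: T) r -> k - d b t - d c t + e <= r.
Proof.
  intros Hd Hk Hl.
  destruct (uniform_positive (fun p e => 0 < d (fst p) t -> 0 < d (snd p) t ->
     forall r, matched d (fst p :: snd p :: T) r -> k - d (fst p) t - d (snd p) t + e <= r)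
     (list_prod T T)) as (e & He & H).
  - intros p e e' H Hle Hb Hc r Hr; specialize (H Hb Hc r Hr); lra.
  - intros (b, c) Hbc; apply in_prod_iff in Hbc; destruct Hbc as (Hb & Hc); simpl.
    destruct (matched_gap d (proj1 (proj2 Hd)) _ (b :: c :: T) (k - d b t - d c t) eq_refl)
      as (e & He & Hg).
    exists e; split; auto; intros Hbt Hct r Hr; destruct (Hg r Hr) as [Hle|Hle]; [|lra].
    generalize (longest_geodesic_end d T k u t b c r Hd Hk Hl Hb Hc Hbt Hct Hr); lra.
  - exists e; split; auto; intros b c r Hb Hc Hbt Hct Hr.
    apply (H (b, c)); auto; apply in_prod; auto.
Qed.

Lemma length_ends {X : Type} (L : list (X * X)) : length (ends L) = (2 * length L)%nat.
Proof.
  induction L as [|p L IH]; auto; change (ends (p :: L)) with (fst p :: snd p :: ends L).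
  simpl in *; lia.
Qed.

(** As [e] exceeds no positive distance from an endpoint to [t], a pair keeps its length, or crosses
    and loses [e], or has both ends away from [t] and is rerouted through the ball. *)
Lemma collapse_edge {X : Type} (d : X -> X -> R) (t : X) (e : R) (p : X * X) :
  is_pseudometric d -> 0 <= e ->
  (0 < d (fst p) t -> e <= d (fst p) t) -> (0 < d (snd p) t -> e <= d (snd p) t) ->
  (~ crosses d t p /\ collapse d t e (fst p) (snd p) = d (fst p) (snd p)) \/
  (crosses d t p /\ collapse d t e (fst p) (snd p) = d (fst p) (snd p) - e) \/
  (0 < d (fst p) t /\ 0 < d (snd p) t /\
   collapse d t e (fst p) (snd p) = d (fst p) t + d (snd p) t - 2 * e).
Proof.
  destruct p as (a, b); unfold crosses, collapse; simpl.
  intros Hd He Ha Hb; assert (H0 := pseudometric_nonneg d Hd); destruct Hd as (Hr & Hs & Ht).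
  generalize (H0 a b) (H0 a t) (H0 b t) (Ht a t b) (Ht a b t) (Ht b a t) (Hs a b) (Hs t b).
  intros; destruct (Req_dec (d a t) 0), (Req_dec (d b t) 0).
  - left; split; [lra|]; unfold Rmin, Rmax; repeat destruct Rle_dec; lra.
  - right; left; split; [lra|].
    assert (e <= d b t) by (apply Hb; lra).
    unfold Rmin, Rmax; repeat destruct Rle_dec; lra.
  - right; left; split; [lra|].
    assert (e <= d a t) by (apply Ha; lra).
    unfold Rmin, Rmax; repeat destruct Rle_dec; lra.
  - assert (e <= d a t) by (apply Ha; lra). assert (e <= d b t) by (apply Hb; lra).
    rewrite !Rmax_right by lra.
    destruct (Rle_lt_dec (d a b) (d a t - e + (d b t - e))).
    + left; split; [lra|apply Rmin_left; auto].
    + right; right; repeat split; try lra; rewrite Rmin_right; lra.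
Qed.

(** A rerouted pair, or two crossing pairs, would leave a remainder that yields a matching of
    [b, c, T]; the gap makes such an [L] cost more than [k] even after the collapse. *)
Lemma collapse_cases {X : Type} (d : X -> X -> R) (T : list X) (k : R) (u t : X) :
  is_pseudometric d -> (forall r, matched d T r -> k <= r) -> longest_geodesic d T k u t ->
  exists e, 0 < e /\ (forall v, In v T -> 0 < d v t -> e <= d v t) /\
  forall L, Permutation (ends L) T ->
    k < cost (collapse d t e) L \/
    (forall p, In p L ->
       ~ crosses d t p /\ collapse d t e (fst p) (snd p) = d (fst p) (snd p)) \/
    (exists p L', Permutation L (p :: L') /\ crosses d t p /\
       collapse d t e (fst p) (snd p) = d (fst p) (snd p) - e /\
       forall q, In q L' -> collapse d t e (fst q) (snd q) = d (fst q) (snd q)).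
Proof.
  intros Hd Hk Hl.
  destruct (longest_geodesic_gap d T k u t Hd Hk Hl) as (g & Hg & Hgap).
  destruct (uniform_positive (fun v e => 0 < d v t -> e <= d v t) T) as (e1 & He1 & Hsep).
  { intros v e e' H Hle Hv; specialize (H Hv); lra. }
  { intros v _; destruct (Rlt_dec 0 (d v t)); [exists (d v t)|exists 1]; split; lra. }
  (* Each pair of a remainder loses at most [2 * e], and the added 1 accounts for the further
     [2 * e] lost by the removed pairs; the factor 3 below makes [2 * e * N < g] strict. *)
  set (N := INR (length T) + 1).
  assert (HN : 1 <= N) by (generalize (pos_INR (length T)); unfold N; lra).
  set (e := Rmin e1 (g / (3 * N))).
  assert (He : 0 < e).
  { apply Rmin_glb_lt; auto; apply Rdiv_lt_0_compat; lra. }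
  assert (HeN : 2 * e * N < g).
  { assert (e * (3 * N) <= g).
    { replace g with (g / (3 * N) * (3 * N)) by (field; lra).
      apply Rmult_le_compat_r; [lra|apply Rmin_r]. }
    nra. }
  assert (Hsep' : forall v, In v T -> 0 < d v t -> e <= d v t).
  { intros v Hv Hvt; apply Rle_trans with e1; [apply Rmin_l|auto]. }
  exists e; repeat split; auto; intros L HL.
  assert (HLN : INR (length L) + 1 <= N).
  { apply Rplus_le_compat_r, le_INR; rewrite <- (Permutation_length HL), length_ends; lia. }
  assert (HinT : forall p, In p L -> In (fst p) T /\ In (snd p) T).
  { intros p Hp; rewrite <- HL; split; apply in_flat_map; exists p; simpl; auto. }
  assert (Hcase : forall p, In p L -> _) by
    (intros p Hp; destruct (HinT p Hp);
     exact (collapse_edge d t e p Hd (Rlt_le _ _ He) (Hsep' _ H) (Hsep' _ H0))).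
  (* It suffices to find [b], [c] away from [t] and a remainder of [L] matching [b, c, T]. *)
  assert (Hbig : forall b c L', In b T -> In c T -> 0 < d b t -> 0 < d c t ->
     matched d (b :: c :: T) (cost d L') -> (length L' <= length L)%nat ->
     d b t + d c t - 2 * e + cost (collapse d t e) L' <= cost (collapse d t e) L ->
     k < cost (collapse d t e) L).
  { intros b c L' Hb Hc Hbt Hct Hm Hlen Hle.
    assert (H1 := Hgap b c _ Hb Hc Hbt Hct Hm).
    assert (H2 := collapse_cost_ge d t e L' Hd (Rlt_le _ _ He)).
    apply le_INR in Hlen.
    assert (2 * e * INR (length L') <= 2 * e * (N - 1)) by (apply Rmult_le_compat_l; lra).
    lra. }
  destruct (classic (exists p, In p L /\ 0 < d (fst p) t /\ 0 < d (snd p) t /\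
     collapse d t e (fst p) (snd p) = d (fst p) t + d (snd p) t - 2 * e))
    as [((b, c) & Hp & Hbt & Hct & E)|Hno]; simpl in *.
  { left; destruct (HinT _ Hp) as (Hb & Hc); simpl in *.
    destruct (in_perm_cons _ _ Hp) as (L' & HL').
    assert (HE := ends_perm _ _ HL').
    change (ends ((b, c) :: L')) with (b :: c :: ends L') in HE.
    apply (Hbig b c L'); auto.
    - apply (matched_double d _ (ends L')); [auto|perm|exists L'; auto].
    - rewrite (Permutation_length HL'); simpl; lia.
    - rewrite (cost_perm_cons _ _ _ _ _ HL'); lra. }
  destruct (classic (exists p, In p L /\ crosses d t p)) as [((a, b) & Hp & Hcr)|Hnocr].
  2:{ right; left; intros p Hp; destruct (Hcase p Hp) as [H|[(H & _)|H]]; auto;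
      exfalso; [apply Hnocr|apply Hno]; eauto. }
  destruct (in_perm_cons _ _ Hp) as (L1 & HL1).
  assert (Hsub : forall q, In q L1 -> In q L) by (intros q Hq; rewrite HL1; simpl; auto).
  assert (Ep : collapse d t e a b = d a b - e).
  { destruct (Hcase _ Hp) as [(H & _)|[(_ & H)|H]]; simpl in *; auto; [tauto|].
    exfalso; apply Hno; eauto. }
  destruct (classic (exists q, In q L1 /\ crosses d t q)) as [((a', b') & Hq & Hcr')|Hnocr].
  - left.
    assert (Eq : collapse d t e a' b' = d a' b' - e).
    { destruct (Hcase _ (Hsub _ Hq)) as [(H & _)|[(_ & H)|H]]; simpl in *; auto; [tauto|].
      exfalso; apply Hno; exists (a', b'); auto. }
    destruct (in_perm_cons _ _ Hq) as (L2 & HL2).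
    destruct (crosses_oriented d t a b Hd Hcr) as (s & v & Hsv & Hab & Hst & Hvt).
    destruct (crosses_oriented d t a' b' Hd Hcr') as (s' & v' & Hsv' & Hab' & Hst' & Hvt').
    assert (HE1 := ends_perm _ _ HL1); assert (HE2 := ends_perm _ _ HL2).
    change (ends ((a, b) :: L1)) with (a :: b :: ends L1) in HE1.
    change (ends ((a', b') :: L2)) with (a' :: b' :: ends L2) in HE2.
    (* The far ends [v], [v'] are doubled, and the near ends [s], [s'] are matched to each other at
       cost 0. *)
    assert (HT : Permutation T (v :: v' :: s :: s' :: ends L2)) by perm.
    apply (Hbig v v' L2); auto; try (rewrite HT; simpl; auto; fail).
    + apply (matched_double d _ (s :: s' :: ends L2)); auto.
      replace (cost d L2) with (d s s' + cost d L2).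
      * apply matched_cons; exists L2; auto.
      * generalize (pseudometric_nonneg d Hd s s') (proj2 (proj2 Hd) s t s')
          (proj1 (proj2 Hd) t s'); lra.
    + rewrite (Permutation_length HL1); simpl; rewrite (Permutation_length HL2); simpl; lia.
    + rewrite (cost_perm_cons _ _ _ _ _ HL1), (cost_perm_cons _ _ _ _ _ HL2); lra.
  - right; right; exists (a, b), L1; repeat split; auto; intros q Hq.
    destruct (Hcase q (Hsub q Hq)) as [(_ & H)|[(H & _)|H]]; auto; exfalso;
      [apply Hnocr|apply Hno]; eauto.
Qed.

(** Since collapsing raises no cost and some pair of [M] crosses, [M] falls into the last case of
    [collapse_cases] and loses exactly [e]. Any other matching either stays above the old minimum or
    loses at most [e], so [M] remains minimal. *)
Lemma collapse_step {X : Type} (d : X -> X -> R) (M : list (X * X)) :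
  is_pseudometric d -> (forall r, matched d (ends M) r -> cost d M <= r) -> 0 < cost d M ->
  exists t e p M', 0 < e /\ Permutation M (p :: M') /\
    (d (fst p) t = 0 /\ e <= d (snd p) t \/ e <= d (fst p) t /\ d (snd p) t = 0) /\
    collapse d t e (fst p) (snd p) = d (fst p) (snd p) - e /\
    (forall q, In q M' -> collapse d t e (fst q) (snd q) = d (fst q) (snd q)) /\
    (forall r, matched (collapse d t e) (ends M) r -> cost (collapse d t e) M <= r).
Proof.
  intros Hd Hmin Hpos.
  destruct (longest_geodesic_exists d M Hd Hpos) as (u & t & Hl).
  destruct (longest_geodesic_crosses d M u t Hd Hmin Hl) as (p0 & Hp0 & Hc0).
  destruct (collapse_cases d _ _ u t Hd Hmin Hl) as (e & He & Hsep & Hcases).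
  assert (HleM : cost (collapse d t e) M <= cost d M)
    by (apply lsum_le; intros; apply collapse_le).
  destruct (Hcases M) as [H|[H|(p & M' & HM & Hc & Ep & Eq)]]; auto.
  - lra.
  - destruct (H _ Hp0); tauto.
  - exists t, e, p, M'; repeat split; auto.
    + assert (Hp : In p M) by (rewrite HM; simpl; auto).
      destruct Hc as [(H1 & H2)|(H1 & H2)]; [left|right]; split; auto;
      apply Hsep; auto; apply in_flat_map; exists p; simpl; auto.
    + assert (Hdrop : forall L q L', Permutation L (q :: L') ->
        collapse d t e (fst q) (snd q) = d (fst q) (snd q) - e ->
        (forall q, In q L' -> collapse d t e (fst q) (snd q) = d (fst q) (snd q)) ->
        cost (collapse d t e) L = cost d L - e).
      { intros L (a, b) L' HL E1 E2; rewrite !(cost_perm_cons _ _ _ _ _ HL).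
        replace (cost (collapse d t e) L') with (cost d L')
          by (symmetry; apply lsum_ext; auto).
        simpl in E1; lra. }
      rewrite (Hdrop _ _ _ HM Ep Eq).
      intros r (L & HL & <-).
      assert (HminL : cost d M <= cost d L) by (apply Hmin; exists L; auto).
      destruct (Hcases L HL) as [H|[H|(q & L' & HL' & _ & E1 & E2)]].
      * lra.
      * replace (cost (collapse d t e) L) with (cost d L); [lra|].
        symmetry; apply lsum_ext; apply H.
      * rewrite (Hdrop _ _ _ HL' E1 E2); lra.
Qed.

(** * Limits of real functions along an ultrafilter *)

Definition is_ultrafilter {P : Type} (U : (P -> Prop) -> Prop) : Prop :=
  (forall A B : P -> Prop, (forall p, A p -> B p) -> U A -> U B) /\
  (forall A B : P -> Prop, U A -> U B -> U (fun p => A p /\ B p)) /\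
  ~ U (fun _ => False) /\
  (forall A : P -> Prop, U A \/ U (fun p => ~ A p)).

(** The sets [B i] form a filter base, nonempty thanks to [q0]; the filter it generates extends to
    an ultrafilter. *)
Lemma ultrafilter_exists {P Q : Type} (B : Q -> P -> Prop) (q0 : Q) :
  (forall i, exists p, B i p) ->
  (forall i j, exists k, forall p, B k p -> B i p /\ B j p) ->
  exists U, is_ultrafilter U /\ forall i, U (B i).
Proof.
  intros Hne Hdir.
  set (F := fun A : P -> Prop => exists i, forall p, B i p -> A p).
  assert (HF : filter.ProperFilter F).
  { constructor; [|constructor].
    - intros (i & Hi); destruct (Hne i) as (p & Hp); exact (Hi p Hp).
    - exists q0; intros; exact Logic.I.
    - intros A A' (i & Hi) (j & Hj); destruct (Hdir i j) as (k & Hk).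
      exists k; intros p Hp; destruct (Hk p Hp); split; auto.
    - intros A A' HA (i & Hi); exists i; auto. }
  destruct (filter.ultraFilterLemma HF) as (U & HU & HFU).
  exists U; split; [|intros i; apply HFU; exists i; auto].
  destruct (filter.ultra_proper (UltraFilter := HU)) as [HP0 [HT HI HS]].
  repeat split.
  - intros A A' HA; apply HS; exact HA.
  - intros A A' HA HA'; exact (HI _ _ HA HA').
  - exact HP0.
  - intros A; exact (@filter.in_ultra_setVsetC _ U A HU).
Qed.

Definition ulim {P : Type} (U : (P -> Prop) -> Prop) (f : P -> R) (l : R) : Prop :=
  forall e, 0 < e -> U (fun p => Rabs (f p - l) < e).

Lemma ulim_const {P : Type} (U : (P -> Prop) -> Prop) (k : R) :
  is_ultrafilter U -> ulim U (fun _ => k) k.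
Proof.
  intros (HS & HI & H0 & HU) e He.
  (* The complement of the empty set belongs to [U]. *)
  destruct (HU (fun _ => False)) as [H|H]; [tauto|].
  revert H; apply HS; intros _ _; rewrite Rminus_diag, Rabs_R0; auto.
Qed.

Lemma ulim_plus {P : Type} (U : (P -> Prop) -> Prop) (f g : P -> R) (k l : R) :
  is_ultrafilter U -> ulim U f k -> ulim U g l -> ulim U (fun p => f p + g p) (k + l).
Proof.
  intros (HS & HI & _) Hf Hg e He.
  assert (He2 : 0 < e / 2) by lra.
  generalize (HI _ _ (Hf _ He2) (Hg _ He2)); apply HS; intros p (H1 & H2).
  replace (f p + g p - (k + l)) with ((f p - k) + (g p - l)) by lra.
  eapply Rle_lt_trans; [apply Rabs_triang|lra].
Qed.

Lemma ulim_opp {P : Type} (U : (P -> Prop) -> Prop) (f : P -> R) (k : R) :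
  is_ultrafilter U -> ulim U f k -> ulim U (fun p => - f p) (- k).
Proof.
  intros (HS & _) Hf e He; generalize (Hf e He); apply HS; intros p H.
  replace (- f p - - k) with (- (f p - k)) by lra; rewrite Rabs_Ropp; auto.
Qed.

Lemma ulim_minus {P : Type} (U : (P -> Prop) -> Prop) (f g : P -> R) (k l : R) :
  is_ultrafilter U -> ulim U f k -> ulim U g l -> ulim U (fun p => f p - g p) (k - l).
Proof. intros HU Hf Hg; apply ulim_plus; auto; apply ulim_opp; auto. Qed.

Lemma ulim_abs {P : Type} (U : (P -> Prop) -> Prop) (f : P -> R) (k : R) :
  is_ultrafilter U -> ulim U f k -> ulim U (fun p => Rabs (f p)) (Rabs k).
Proof.
  intros (HS & _) Hf e He; generalize (Hf e He); apply HS; intros p H.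
  eapply Rle_lt_trans; [apply Rabs_triang_inv2|auto].
Qed.

Lemma ulim_lsum {P A : Type} (U : (P -> Prop) -> Prop) (f : A -> P -> R) (k : A -> R)
  (l : list A) :
  is_ultrafilter U -> (forall a, In a l -> ulim U (f a) (k a)) ->
  ulim U (fun p => lsum (fun a => f a p) l) (lsum k l).
Proof.
  intros HU; induction l as [|a l IH]; intros H.
  - exact (ulim_const U 0 HU).
  - rewrite lsum_cons; apply (ulim_plus U (f a) (fun p => lsum (fun a => f a p) l)); auto.
    + apply H; simpl; auto.
    + apply IH; intros; apply H; simpl; auto.
Qed.

Lemma ulim_le {P : Type} (U : (P -> Prop) -> Prop) (f g : P -> R) (k l : R) :
  is_ultrafilter U -> ulim U f k -> ulim U g l -> U (fun p => f p <= g p) -> k <= l.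
Proof.
  intros (HS & HI & H0 & _) Hf Hg Hle; apply Rnot_lt_le; intros Hlt; apply H0.
  assert (He : 0 < (k - l) / 2) by lra.
  generalize (HI _ _ Hle (HI _ _ (Hf _ He) (Hg _ He))); apply HS; intros p (H1 & H2 & H3).
  apply Rabs_def2 in H2; apply Rabs_def2 in H3; lra.
Qed.

Lemma ulim_eq {P : Type} (U : (P -> Prop) -> Prop) (f g : P -> R) (k l : R) :
  is_ultrafilter U -> ulim U f k -> ulim U g l -> U (fun p => f p = g p) -> k = l.
Proof.
  intros HU Hf Hg He; apply Rle_antisym;
  [apply (ulim_le U f g)|apply (ulim_le U g f)]; auto;
  revert He; apply (proj1 HU); intros p ->; lra.
Qed.

(** The limit is the supremum of all [s] with [s <= f p] for [U]-almost all [p]. *)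
Lemma ulim_exists {P : Type} (U : (P -> Prop) -> Prop) (f : P -> R) (M : R) :
  is_ultrafilter U -> U (fun p => Rabs (f p) <= M) -> exists l, ulim U f l.
Proof.
  intros (HS & HI & H0 & HU) HM.
  destruct (completeness (fun s => U (fun p => s <= f p))) as (l & Hub & Hlub).
  - exists M; intros s Hs; apply Rnot_lt_le; intros Hlt; apply H0.
    generalize (HI _ _ HM Hs); apply HS; intros p (H1 & H2).
    generalize (Rle_abs (f p)); lra.
  - exists (- M); revert HM; apply HS; intros p H1.
    generalize (Rle_abs (- f p)); rewrite Rabs_Ropp; lra.
  - exists l; intros e He.
    assert (H1 : U (fun p => l - e < f p)).
    { apply NNPP; intros Hn; enough (l <= l - e) by lra.
      apply Hlub; intros s Hs; apply Rnot_lt_le; intros Hlt; apply Hn.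
      revert Hs; apply HS; intros p; lra. }
    assert (H2 : U (fun p => ~ l + e <= f p)).
    { destruct (HU (fun p => l + e <= f p)) as [H|H]; auto.
      apply Hub in H; lra. }
    generalize (HI _ _ H1 H2); apply HS; intros p (H3 & H4); apply Rabs_def1; lra.
Qed.

(** An unspecified real when no limit exists. *)
Definition ulimit {P : Type} (U : (P -> Prop) -> Prop) (f : P -> R) : R :=
  epsilon (inhabits 0) (ulim U f).

Lemma ulimit_spec {P : Type} (U : (P -> Prop) -> Prop) (f : P -> R) (M : R) :
  is_ultrafilter U -> U (fun p => Rabs (f p) <= M) -> ulim U f (ulimit U f).
Proof. intros HU HM; unfold ulimit; apply epsilon_spec, (ulim_exists U f M); auto. Qed.

(** * Minimality of the given pairs among the matchings of their endpoints *)

Definition pairs {X I : Type} (x y : I -> X) (l : list I) : list (X * X) :=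
  map (fun i => (x i, y i)) l.

Lemma cost_pairs {X I : Type} (d : X -> X -> R) (x y : I -> X) (l : list I) :
  cost d (pairs x y l) = lsum (fun i => d (x i) (y i)) l.
Proof.
  induction l as [|i l IH]; [reflexivity|].
  unfold cost in *; simpl; rewrite !lsum_cons, IH; reflexivity.
Qed.

Definition update {I : Type} (a : I -> R) (i : I) (v : R) (j : I) : R :=
  if eq_dec_classic j i then v else a j.

Lemma update_eq {I : Type} (a : I -> R) (i : I) (v : R) : update a i v i = v.
Proof. unfold update; destruct (eq_dec_classic i i); congruence. Qed.

Lemma update_neq {I : Type} (a : I -> R) (i j : I) (v : R) : j <> i -> update a i v j = a j.
Proof. unfold update; destruct (eq_dec_classic j i); congruence. Qed.

Lemma in_ends_pairs {X I : Type} (x y : I -> X) (l : list I) (p : X) :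
  In p (ends (pairs x y l)) -> exists i, In i l /\ (p = x i \/ p = y i).
Proof.
  intros H; apply in_flat_map in H; destruct H as (e & He & H).
  apply in_map_iff in He; destruct He as (i & <- & Hi).
  exists i; simpl in H; intuition.
Qed.

(* The signs orient the pairs along the alternating walk that starts at [u]. *)
Lemma matched_alternating_signs {X I : Type} (d : X -> X -> R) (x y : I -> X) :
  (forall a b, d a b = d b a) ->
  forall (n : nat) (l : list I) (u v : X) (r : R), length l = n -> NoDup l ->
  matched d (u :: v :: ends (pairs x y l)) r ->
  exists a : I -> R, (forall i, a i = 1 \/ a i = -1) /\
    forall (K : R) (f : X -> R), (forall p q, f p - f q <= K * d p q) ->
      f u - f v + lsum (fun i => a i * (f (x i) - f (y i))) l <= K * r.
Proof.
  intros Hs; induction n as [n IH] using lt_wf_ind; intros l u v r Hn Hnd Hm.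
  (* The walk traverses the pair [i] with sign [sg]; the induction hypothesis supplies the signs on
     [l']. *)
  assert (Hstep : forall i l' u' v' r' sg, Permutation l (i :: l') -> sg = 1 \/ sg = -1 ->
    matched d (u' :: v' :: ends (pairs x y l')) r' ->
    exists a : I -> R, (forall i, a i = 1 \/ a i = -1) /\ a i = sg /\
    forall (K : R) (f : X -> R), (forall p q, f p - f q <= K * d p q) ->
      f u' - f v' + lsum (fun i => a i * (f (x i) - f (y i))) l <=
      K * r' + sg * (f (x i) - f (y i))).
  { intros i l' u' v' r' sg Hl Hsg Hm'.
    assert (Hnd' := Permutation_NoDup Hl Hnd); inversion Hnd' as [|? ? Hi Hnd'']; subst.
    destruct (IH (length l')) with (l := l') (u := u') (v := v') (r := r')
      as (a & Ha & H); auto.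
    { apply Permutation_length in Hl; simpl in Hl; lia. }
    exists (update a i sg); repeat split.
    - intros j; unfold update; destruct (eq_dec_classic j i); auto.
    - apply update_eq.
    - intros K f Hf; specialize (H K f Hf).
      rewrite (lsum_perm _ _ _ Hl), lsum_cons, update_eq.
      rewrite (lsum_ext _ (fun i => a i * (f (x i) - f (y i))) l'); [lra|].
      intros j Hj; rewrite update_neq; [reflexivity|congruence]. }
  destruct (matched_inv d _ _ _ Hs Hm) as (p & T0 & r0 & HT & Hm0 & ->).
  destruct (classic (p = v)) as [->|Hpv].
  (* The walk closes at [v]; a new cycle starts with any remaining pair. *)
  - assert (HT0 : Permutation T0 (ends (pairs x y l))) by perm.
    apply (matched_perm d _ _ _ HT0) in Hm0.
    destruct l as [|i l].
    + exists (fun _ => 1); split; auto; intros K f Hf; rewrite lsum_nil.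
      destruct Hm0 as (L & HL & <-); symmetry in HL; apply Permutation_nil in HL.
      destruct L; [|discriminate]; unfold cost; rewrite lsum_nil.
      specialize (Hf u v); lra.
    + destruct (Hstep i l (x i) (y i) r0 1) as (a & Ha & Hai & H); auto.
      exists a; split; auto; intros K f Hf; specialize (H K f Hf); specialize (Hf u v); lra.
  - assert (Hp : In p (ends (pairs x y l))).
    { assert (Hp : In p (v :: ends (pairs x y l))) by (rewrite HT; simpl; auto).
      simpl in Hp; destruct Hp; [congruence|auto]. }
    destruct (in_ends_pairs x y l p Hp) as (i & Hi & Hpi).
    destruct (in_perm_cons _ _ Hi) as (l' & Hl).
    assert (HE := ends_perm _ _ (Permutation_map (fun i => (x i, y i)) Hl)).
    change (Permutation (ends (pairs x y l)) (x i :: y i :: ends (pairs x y l'))) in HE.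
    destruct Hpi as [->| ->].
    (* Having arrived at [x i], the walk goes on from [y i]; the sign -1 makes the increments
       telescope. *)
    + destruct (Hstep i l' (y i) v r0 (-1)) as (a & Ha & Hai & H); auto.
      { apply (matched_perm d T0); auto; perm. }
      exists a; split; auto; intros K f Hf; specialize (H K f Hf); specialize (Hf u (x i)); lra.
    + destruct (Hstep i l' (x i) v r0 1) as (a & Ha & Hai & H); auto.
      { apply (matched_perm d T0); auto; perm. }
      exists a; split; auto; intros K f Hf; specialize (H K f Hf); specialize (Hf u (y i)); lra.
Qed.

Lemma metric_pseudometric {X : Type} (d : X -> X -> R) : is_metric X d -> is_pseudometric d.
Proof.
  intros (_ & H0 & Hs & Ht); repeat split; auto; intros a; apply H0; auto.
Qed.

Lemma metric_pos {X : Type} (d : X -> X -> R) (a b : X) : is_metric X d -> a <> b -> 0 < d a b.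
Proof.
  intros (Hn & H0 & _) Hab; destruct (Hn a b) as [H|H]; auto.
  exfalso; apply Hab, H0; auto.
Qed.

Lemma lip_norm_le_sub {X : Type} (d : X -> X -> R) (f : X -> R) (K : R) (a b : X) :
  is_metric X d -> lip_norm_le d f K -> f a - f b <= K * d a b.
Proof.
  intros Hd Hf; destruct (classic (a = b)) as [->|Hab].
  - rewrite (proj1 (metric_pseudometric d Hd)); lra.
  - assert (Hpos := metric_pos d a b Hd Hab); specialize (Hf a b Hab).
    apply Rle_trans with (Rabs (f a - f b)); [apply Rle_abs|].
    apply (Rmult_le_compat_r (d a b)) in Hf; [|lra].
    unfold Rdiv in Hf; rewrite Rmult_assoc, Rinv_l in Hf; lra.
Qed.

(** Interpolating the signs of the alternating walks bounds the cost by [K * r] for every admissible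
    [K], and the infimum of these [K] is 1. *)
Lemma pairs_minimal {X I : Type} (d : X -> X -> R) (x0 : X) (x y : I -> X) (l : list I) (r : R) :
  is_metric X d -> (forall i, x i <> y i) -> lip_interp_constant d x0 x y 1 -> NoDup l ->
  matched d (ends (pairs x y l)) r -> cost d (pairs x y l) <= r.
Proof.
  intros Hd Hxy (_ & Hinf) Hnd Hm.
  assert (Hps := metric_pseudometric d Hd).
  assert (Hr : 0 <= r).
  { destruct Hm as (L & _ & <-); apply lsum_nonneg; intros; apply pseudometric_nonneg; auto. }
  (* Two copies of the base point serve as start and end of the walk at cost 0. *)
  assert (Hm' : matched d (x0 :: x0 :: ends (pairs x y l)) r).
  { replace r with (d x0 x0 + r) by (rewrite (proj1 Hps); lra); apply matched_cons; auto. }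
  destruct (matched_alternating_signs d x y (proj1 (proj2 Hps)) _ l x0 x0 r eq_refl Hnd Hm')
    as (a & Ha & H).
  assert (HK : forall K, interp_const_set d x0 x y K -> cost d (pairs x y l) <= K * r).
  { intros K (_ & HKset); destruct (HKset a) as (f & _ & Hf & Hfa).
    { intros i; destruct (Ha i) as [-> | ->]; unfold Rabs; destruct Rcase_abs; lra. }
    specialize (H K f (fun p q => lip_norm_le_sub d f K p q Hd Hf)).
    rewrite cost_pairs, (lsum_ext _ (fun i => a i * (f (x i) - f (y i))) l); [lra|].
    intros i _; assert (Hpos := metric_pos d _ _ Hd (Hxy i)).
    assert (E : f (x i) - f (y i) = a i * d (x i) (y i)).
    { rewrite <- Hfa; unfold Tmap; field; lra. }
    rewrite E; destruct (Ha i) as [-> | ->]; lra. }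
  destruct (Req_dec r 0) as [->|Hr0].
  - destruct (classic (exists K, interp_const_set d x0 x y K)) as [(K & HKs)|Hno].
    + specialize (HK K HKs); lra.
    (* Without an admissible [K], the number 2 would be a lower bound exceeding the infimum 1. *)
    + exfalso; enough (2 <= 1) by lra; apply Hinf; intros K HKs; exfalso; eauto.
  - apply Rnot_lt_le; intros Hlt.
    assert (Hq : cost d (pairs x y l) / r <= 1).
    { apply Hinf; intros K HKs; specialize (HK K HKs).
      apply (Rmult_le_reg_r r); [lra|].
      unfold Rdiv; rewrite Rmult_assoc, Rinv_l; lra. }
    apply (Rmult_le_compat_r r) in Hq; [|lra].
    unfold Rdiv in Hq; rewrite Rmult_assoc, Rinv_l in Hq; lra.
Qed.

(** * Reductions and the case of finitely many indices *)

(* [g] is a partial solution for [d0], and a full solution for [d] can be added to it. *)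
Definition reduction {X I : Type} (d0 : X -> X -> R) (x0 : X) (x y : I -> X) (l : list I)
  (s : (X -> X -> R) * (I -> X -> R)) : Prop :=
  let (d, g) := s in
  is_pseudometric d /\
  (forall r, matched d (ends (pairs x y l)) r -> cost d (pairs x y l) <= r) /\
  (forall u v, lsum (fun i => Rabs (g i u - g i v)) l <= d0 u v - d u v) /\
  (forall i, In i l -> g i (x i) - g i (y i) = d0 (x i) (y i) - d (x i) (y i)) /\
  (forall i, In i l -> g i x0 = 0).

Lemma lsum_term_le {A : Type} (g : A -> R) (a : A) (l : list A) :
  (forall b, 0 <= g b) -> In a l -> g a <= lsum g l.
Proof.
  intros H Ha; destruct (in_perm_cons _ _ Ha) as (l' & Hl).
  rewrite (lsum_perm _ _ _ Hl), lsum_cons.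
  assert (0 <= lsum g l') by (apply lsum_nonneg; auto); lra.
Qed.

(** One collapse moves the length [e] of a single pair [i] from [d] into [g i]; [collapse_drop]
    keeps the sum bound. *)
Lemma reduction_step {X I : Type} (d0 : X -> X -> R) (x0 : X) (x y : I -> X) (l : list I)
  (d : X -> X -> R) (g : I -> X -> R) :
  NoDup l -> reduction d0 x0 x y l (d, g) -> 0 < cost d (pairs x y l) ->
  exists d' g', reduction d0 x0 x y l (d', g') /\
    cost d' (pairs x y l) < cost d (pairs x y l).
Proof.
  intros Hnd (Hd & Hmin & Hsum & Hdiag & Hx0) Hpos.
  destruct (collapse_step d (pairs x y l) Hd Hmin Hpos)
    as (t & e & p & M' & He & HM & Hp & Ep & Eq & Hmin').
  symmetry in HM; apply Permutation_map_inv in HM; destruct HM as (l' & HM & Hl).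
  destruct l' as [|i l']; [discriminate|injection HM as -> ->].
  assert (Hnd' := Permutation_NoDup Hl Hnd); inversion Hnd' as [|? ? Hi Hnd'']; subst.
  simpl in Hp, Ep.
  assert (Eq' : forall j, In j l' -> collapse d t e (x j) (y j) = d (x j) (y j)).
  { intros j Hj; apply (Eq (x j, y j)), in_map_iff; eauto. }
  (* The sign depends on which of [x i], [y i] is at distance 0 from [t]. *)
  assert (Hsg : exists sg, Rabs sg = 1 /\ sg * (Rmin (d (x i) t) e - Rmin (d (y i) t) e) = e).
  { destruct Hp as [(H1 & H2)|(H1 & H2)]; [exists (-1)|exists 1];
    (split; [unfold Rabs; destruct Rcase_abs; lra|]);
    unfold Rmin; repeat destruct Rle_dec; lra. }
  destruct Hsg as (sg & Hsg1 & Hsg).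
  set (h := fun v => sg * (Rmin (d v t) e - Rmin (d x0 t) e)).
  set (g' := fun j v => g j v + (if eq_dec_classic j i then h v else 0)).
  assert (Hgi : forall v, g' i v = g i v + h v).
  { intros v; unfold g'; destruct (eq_dec_classic i i); congruence. }
  assert (Hgj : forall j v, In j l' -> g' j v = g j v).
  { intros j v Hj; unfold g'; destruct (eq_dec_classic j i); [congruence|lra]. }
  exists (collapse d t e), g'; split; [repeat split|].
  - apply collapse_pseudometric; auto.
  - apply collapse_pseudometric; auto.
  - apply collapse_pseudometric; auto.
  - exact Hmin'.
  - intros u v; specialize (Hsum u v).
    rewrite (lsum_perm _ _ _ Hl), lsum_cons in Hsum.
    rewrite (lsum_perm _ _ _ Hl), lsum_cons.
    rewrite (lsum_ext _ (fun j => Rabs (g j u - g j v)) l')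
      by (intros j Hj; rewrite !Hgj by auto; reflexivity).
    rewrite !Hgi.
    assert (Hh : Rabs (h u - h v) <= d u v - collapse d t e u v).
    { unfold h; replace (_ - _) with (sg * (Rmin (d u t) e - Rmin (d v t) e)) by lra.
      rewrite Rabs_mult, Hsg1, Rmult_1_l; apply collapse_drop; auto. }
    generalize (Rabs_triang (g i u - g i v) (h u - h v)).
    replace (g i u - g i v + (h u - h v)) with (g i u + h u - (g i v + h v)) by lra; lra.
  - intros j Hj; specialize (Hdiag j Hj); rewrite Hl in Hj; destruct Hj as [<-|Hj].
    + rewrite !Hgi, Ep.
      assert (h (x i) - h (y i) = e) by (unfold h; lra); lra.
    + rewrite !Hgj, (Eq' j Hj) by auto; auto.
  - intros j Hj; specialize (Hx0 j Hj); unfold g', h; rewrite Hx0.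
    destruct (eq_dec_classic j i); lra.
  - rewrite !cost_pairs, !(lsum_perm _ _ _ Hl), !lsum_cons, Ep.
    rewrite (lsum_ext _ _ l' Eq'); lra.
Qed.

(** These bounds do not depend on the reduction, so limits along an ultrafilter exist. *)
Lemma reduction_bound {X I : Type} (d0 : X -> X -> R) (x0 : X) (x y : I -> X) (l : list I)
  (d : X -> X -> R) (g : I -> X -> R) :
  reduction d0 x0 x y l (d, g) ->
  (forall u v, Rabs (d u v) <= d0 u v) /\
  (forall i u, In i l -> Rabs (g i u) <= d0 u x0).
Proof.
  intros (Hd & _ & Hsum & _ & Hx0); assert (H0 := pseudometric_nonneg d Hd).
  assert (Hs0 : forall u v, 0 <= lsum (fun i => Rabs (g i u - g i v)) l)
    by (intros; apply lsum_nonneg; intros; apply Rabs_pos).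
  split.
  - intros u v; rewrite Rabs_right by (apply Rle_ge; auto).
    generalize (Hs0 u v) (Hsum u v); lra.
  - intros i u Hi.
    assert (H1 := lsum_term_le (fun i => Rabs (g i u - g i x0)) i l
                    (fun _ => Rabs_pos _) Hi); simpl in H1.
    rewrite (Hx0 i Hi), Rminus_0_r in H1; generalize (H0 u x0) (Hsum u x0); lra.
Qed.

Lemma reduction_minimizer {X I : Type} (d0 : X -> X -> R) (x0 : X) (x y : I -> X) (l : list I)
  (s0 : (X -> X -> R) * (I -> X -> R)) :
  reduction d0 x0 x y l s0 ->
  exists s, reduction d0 x0 x y l s /\
    forall s', reduction d0 x0 x y l s' ->
      cost (fst s) (pairs x y l) <= cost (fst s') (pairs x y l).
Proof.
  intros Hs0; set (M := pairs x y l).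
  assert (Hnn : forall s, reduction d0 x0 x y l s -> 0 <= cost (fst s) M).
  { intros (d, g) (Hd & _); apply lsum_nonneg; intros; apply pseudometric_nonneg; auto. }
  (* The infimum of the remaining costs is [- m]. *)
  destruct (completeness (fun c => exists s, reduction d0 x0 x y l s /\ c = - cost (fst s) M))
    as (m & Hub & Hlub).
  { exists 0; intros c (s & Hs & ->); specialize (Hnn s Hs); lra. }
  { eauto. }
  assert (Hm : forall s, reduction d0 x0 x y l s -> - m <= cost (fst s) M).
  { intros s Hs; enough (- cost (fst s) M <= m) by lra; apply Hub; eauto. }
  (* The ultrafilter contains, for each [e], the reductions within [e] of the infimum; all defining
     conditions pass to the pointwise limit. *)
  destruct (ultrafilter_exists (fun (e : posreal) s => reduction d0 x0 x y l s /\
      cost (fst s) M <= - m + e) (mkposreal 1 Rlt_0_1)) as (U & HU & HB).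
  { intros e; apply NNPP; intros Hno; enough (m <= m - e) by (generalize (cond_pos e); lra).
    apply Hlub; intros c (s & Hs & ->); apply Rnot_lt_le; intros Hlt; apply Hno.
    exists s; split; auto; lra. }
  { intros e e'; exists (mkposreal (Rmin e e') (Rmin_stable_in_posreal e e')); simpl.
    intros s (H1 & H2); generalize (Rmin_l e e') (Rmin_r e e').
    repeat split; auto; lra. }
  assert (Hev : forall Q : _ -> Prop, (forall s, reduction d0 x0 x y l s -> Q s) -> U Q).
  { intros Q HQ; apply (proj1 HU _ Q (fun s Hs => HQ s (proj1 Hs)) (HB (mkposreal 1 Rlt_0_1))). }
  set (d := fun u v => ulimit U (fun s => fst s u v)).
  set (g := fun i u => ulimit U (fun s => snd s i u)).
  assert (Hdl : forall u v, ulim U (fun s => fst s u v) (d u v)).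
  { intros u v; apply (ulimit_spec U _ (d0 u v)); auto; apply Hev.
    intros (d', g') Hs; apply (reduction_bound _ _ _ _ _ _ _ Hs). }
  assert (Hgl : forall i u, In i l -> ulim U (fun s => snd s i u) (g i u)).
  { intros i u Hi; apply (ulimit_spec U _ (d0 u x0)); auto; apply Hev.
    intros (d', g') Hs; apply (reduction_bound _ _ _ _ _ _ _ Hs); auto. }
  assert (Hcl : forall L, ulim U (fun s => cost (fst s) L) (cost d L)).
  { intros L; apply (ulim_lsum U (fun e s => fst s (fst e) (snd e))); auto. }
  exists (d, g); split; [repeat split|].
  - intros a; apply (ulim_eq U _ (fun _ => 0) _ _ HU (Hdl a a)); [apply ulim_const; auto|].
    apply Hev; intros (d', g') (Hd & _); apply Hd.
  - intros a b; apply (ulim_eq U _ _ _ _ HU (Hdl a b) (Hdl b a)).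
    apply Hev; intros (d', g') (Hd & _); apply Hd.
  - intros a b c.
    apply (ulim_le U _ _ _ _ HU (Hdl a c) (ulim_plus U _ _ _ _ HU (Hdl a b) (Hdl b c))).
    apply Hev; intros (d', g') (Hd & _); apply Hd.
  - intros r (L & HL & <-); apply (ulim_le U _ _ _ _ HU (Hcl M) (Hcl L)).
    apply Hev; intros (d', g') (_ & Hmin & _); apply Hmin; exists L; auto.
  - intros u v.
    apply (ulim_le U (fun s => lsum (fun i => Rabs (snd s i u - snd s i v)) l)
             (fun s => d0 u v - fst s u v)); auto.
    + apply (ulim_lsum U (fun i s => Rabs (snd s i u - snd s i v))); auto.
      intros i Hi; apply ulim_abs; auto; apply ulim_minus; auto.
    + apply ulim_minus; auto; apply ulim_const; auto.
    + apply Hev; intros (d', g') (_ & _ & Hsum & _); apply Hsum.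
  - intros i Hi.
    apply (ulim_eq U (fun s => snd s i (x i) - snd s i (y i))
             (fun s => d0 (x i) (y i) - fst s (x i) (y i))); auto.
    + apply ulim_minus; auto.
    + apply ulim_minus; auto; apply ulim_const; auto.
    + apply Hev; intros (d', g') (_ & _ & _ & Hdiag & _); apply Hdiag; auto.
  - intros i Hi; apply (ulim_eq U _ (fun _ => 0) _ _ HU (Hgl i x0 Hi)); [apply ulim_const; auto|].
    apply Hev; intros (d', g') (_ & _ & _ & _ & Hx0); apply Hx0; auto.
  - intros s' Hs'; apply Rle_trans with (- m); [|apply Hm; auto].
    apply Rnot_lt_le; intros Hlt; simpl in Hlt.
    assert (He : 0 < (cost d M + m) / 2) by lra.
    assert (cost d M <= - m + (cost d M + m) / 2); [|lra].
    apply (ulim_le U _ (fun _ => - m + (cost d M + m) / 2) _ _ HU (Hcl M));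
      [apply ulim_const; auto|].
    apply (proj1 HU _ _ (fun s Hs => proj2 Hs) (HB (mkposreal _ He))).
Qed.

(** Multiplied out by the distance, to make sense for pseudometrics. For distinct indices in [l],
    the off-diagonal zeros follow from the first two clauses. *)
Definition partial_beurling {X I : Type} (d : X -> X -> R) (x0 : X) (x y : I -> X) (l : list I)
  (g : I -> X -> R) : Prop :=
  (forall u v, lsum (fun i => Rabs (g i u - g i v)) l <= d u v) /\
  (forall i, In i l -> g i (x i) - g i (y i) = d (x i) (y i)) /\
  (forall i, In i l -> g i x0 = 0).

(** Starting from [g = 0], a best reduction has remaining cost 0, so its [d] vanishes on every pair
    and [g] carries the full distance. *)
Lemma partial_beurling_exists {X I : Type} (d0 : X -> X -> R) (x0 : X) (x y : I -> X)
  (l : list I) :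
  is_pseudometric d0 -> NoDup l ->
  (forall r, matched d0 (ends (pairs x y l)) r -> cost d0 (pairs x y l) <= r) ->
  exists g, partial_beurling d0 x0 x y l g.
Proof.
  intros Hd0 Hnd Hmin.
  destruct (reduction_minimizer d0 x0 x y l (d0, fun _ _ => 0)) as ((d, g) & Hs & Hbest).
  { repeat split; try apply Hd0; auto.
    - intros u v; rewrite Rminus_diag, Rabs_R0.
      rewrite (lsum_ext _ (fun _ => 0 * 0)), lsum_scal by (intros; lra); lra.
    - intros; lra. }
  assert (Hcost : cost d (pairs x y l) <= 0).
  { apply Rnot_lt_le; intros Hpos.
    destruct (reduction_step d0 x0 x y l d g Hnd Hs Hpos) as (d' & g' & Hs' & Hlt).
    specialize (Hbest _ Hs'); simpl in Hbest; lra. }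
  destruct Hs as (Hd & _ & Hsum & Hdiag & Hx0); assert (H0 := pseudometric_nonneg d Hd).
  exists g; repeat split; auto.
  - intros u v; generalize (Hsum u v) (H0 u v); lra.
  - intros i Hi; rewrite cost_pairs in Hcost.
    assert (H1 := lsum_term_le (fun i => d (x i) (y i)) i l (fun _ => H0 _ _) Hi).
    simpl in H1; rewrite (Hdiag i Hi); generalize (H0 (x i) (y i)); lra.
Qed.

(** * Passage to arbitrary index sets *)

Lemma lsum_incl {A : Type} (g : A -> R) (l l' : list A) :
  (forall a, 0 <= g a) -> NoDup l -> incl l l' -> lsum g l <= lsum g l'.
Proof.
  intros Hg; revert l'; induction l as [|a l IH]; intros l' Hnd Hin.
  - rewrite lsum_nil; apply lsum_nonneg; auto.
  - inversion Hnd as [|? ? Ha Hnd']; subst.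
    destruct (in_perm_cons a l') as (l1 & Hl1); [apply Hin; simpl; auto|].
    rewrite (lsum_perm _ _ _ Hl1), !lsum_cons; apply Rplus_le_compat_l, IH; auto.
    intros b Hb; assert (Hb' : In b (a :: l1)) by (rewrite <- Hl1; apply Hin; simpl; auto).
    destruct Hb' as [->|]; tauto.
Qed.

Theorem theorem3p15 (X : Type) (d : X -> X -> R) (x0 : X) (I : Type)
  (x y : I -> X)
  (Hmetric : is_metric X d)
  (Hfam : forall i, x i <> y i)
  (Hinterp : lip_interpolating d x0 x y)
  (Hconst : lip_interp_constant d x0 x y 1) :
  exists f : I -> X -> R,
    (forall i, is_Lip0 d x0 (f i)) /\
    (forall i j, i = j -> (f i (x j) - f i (y j)) / d (x j) (y j) = 1) /\
    (forall i j, i <> j -> (f i (x j) - f i (y j)) / d (x j) (y j) = 0) /\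
    beurling_sum_le d f 1.
Proof.
  assert (Hps := metric_pseudometric d Hmetric).
  (* The limit runs over partial solutions on finite index lists, directed by inclusion. *)
  destruct (ultrafilter_exists (fun l0 (s : list I * (I -> X -> R)) =>
      incl l0 (fst s) /\ partial_beurling d x0 x y (fst s) (snd s)) []) as (U & HU & HB).
  { intros l0; set (l := nodup eq_dec_classic l0).
    assert (Hnd : NoDup l) by apply NoDup_nodup.
    destruct (partial_beurling_exists d x0 x y l Hps Hnd) as (g & Hg).
    { intros r; apply (pairs_minimal d x0); auto. }
    exists (l, g); split; auto; intros i Hi; apply nodup_In; auto. }
  { intros l l'; exists (l ++ l'); intros s (Hin & Hs).
    split; (split; [intros i Hi; apply Hin, in_or_app; auto|auto]). }
  assert (Hev : forall l0 (Q : _ -> Prop), (forall l g, incl l0 l ->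
      partial_beurling d x0 x y l g -> Q (l, g)) -> U Q).
  { intros l0 Q HQ; refine (proj1 HU _ Q _ (HB l0)); intros (l, g) (H1 & H2); auto. }
  set (f := fun i u => ulimit U (fun s => snd s i u)).
  assert (Hfl : forall i u, ulim U (fun s => snd s i u) (f i u)).
  { intros i u; apply (ulimit_spec U _ (d u x0)); auto; apply (Hev [i]).
    intros l g Hin (Hsum & _ & Hx0); simpl.
    assert (Hi : In i l) by (apply Hin; simpl; auto).
    assert (H1 := lsum_term_le (fun i => Rabs (g i u - g i x0)) i l (fun _ => Rabs_pos _) Hi).
    simpl in H1; rewrite (Hx0 i Hi), Rminus_0_r in H1; eapply Rle_trans; eauto. }
  assert (Hsum : forall u v l0, NoDup l0 -> lsum (fun i => Rabs (f i u - f i v)) l0 <= d u v).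
  { intros u v l0 Hnd.
    apply (ulim_le U (fun s => lsum (fun i => Rabs (snd s i u - snd s i v)) l0)
             (fun _ => d u v)); auto.
    - apply (ulim_lsum U (fun i s => Rabs (snd s i u - snd s i v))); auto.
      intros i Hi; apply ulim_abs; auto; apply ulim_minus; auto.
    - apply ulim_const; auto.
    - apply (Hev l0); intros l g Hin (Hs & _); simpl.
      eapply Rle_trans; [|apply Hs].
      apply lsum_incl; auto; intros; apply Rabs_pos. }
  assert (Hdiag : forall i, f i (x i) - f i (y i) = d (x i) (y i)).
  { intros i; apply (ulim_eq U (fun s => snd s i (x i) - snd s i (y i))
                       (fun _ => d (x i) (y i))); auto.
    - apply ulim_minus; auto.
    - apply ulim_const; auto.
    - apply (Hev [i]); intros l g Hin (_ & Hg & _); apply Hg, Hin; simpl; auto. }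
  assert (Hbeurling : beurling_sum_le d f 1).
  { intros u v Huv l0 Hnd; assert (Hpos := metric_pos d u v Hmetric Huv).
    rewrite (lsum_ext _ (fun i => / d u v * Rabs (f i u - f i v)))
      by (intros; unfold Rdiv; apply Rmult_comm).
    rewrite lsum_scal, <- (Rinv_l (d u v)) by lra.
    apply Rmult_le_compat_l; auto; left; apply Rinv_0_lt_compat; auto. }
  exists f; repeat split; auto.
  - apply (ulim_eq U _ (fun _ => 0) _ _ HU (Hfl i x0)); [apply ulim_const; auto|].
    apply (Hev [i]); intros l g Hin (_ & _ & Hg); apply Hg, Hin; simpl; auto.
  - exists 1; intros u v Huv.
    assert (H := Hbeurling u v Huv [i]); rewrite lsum_cons, lsum_nil, Rplus_0_r in H.
    apply H; repeat constructor; intros [].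
  - intros i j <-; rewrite Hdiag; assert (Hpos := metric_pos d _ _ Hmetric (Hfam i)).
    field; lra.
  (* At the pair [j] the term of [f j] alone exhausts the bound on the sum, so the term of [f i] is
     0. *)
  - intros i j Hij; assert (Hpos := metric_pos d _ _ Hmetric (Hfam j)).
    assert (H := Hsum (x j) (y j) [i; j]).
    rewrite !lsum_cons, lsum_nil, Hdiag, (Rabs_right (d _ _)) in H by lra.
    assert (Hz : Rabs (f i (x j) - f i (y j)) <= 0).
    { enough (Rabs (f i (x j) - f i (y j)) + (d (x j) (y j) + 0) <= d (x j) (y j)) by lra.
      apply H; repeat constructor; simpl; intuition. }
    assert (E : f i (x j) - f i (y j) = 0).
    { destruct (Req_dec (f i (x j) - f i (y j)) 0) as [|Hn]; auto.
      apply Rabs_pos_lt in Hn; lra. }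
    rewrite E; unfold Rdiv; lra.
Qed.
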